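(* Let $G=(S,R,\rho)$ be a $q$-grammar such that $R(s_{i+1})=q\uparrow R(s_i)$ for every $s_i\in\mathbb{S}$, and let $\phi$ be a master-linear evaluation. Then for all $f,g\in\mathbb{E}$, \[ \phi\big(\mathrm{Gen}^{(G)}_q(fg;u)\big)=\phi\big(\mathrm{Gen}^{(G)}_q(f;u)\big)\cdot\phi\big(\mathrm{Gen}^{(G)}_q(g;u)\big). \]
   Context: $\mathbb{K}$ is a commutative ring with unity and characteristic zero, $q$ an indeterminate. For a set $S$ of master variables, $\mathbb{S}=\{s_i:s\in S,\ i\ge0\}$ is a set of non-commuting variables, $F(\mathbb{S})$ the free group on $\mathbb{S}$, $\mathbb{E}=\mathbb{K}[q][F(\mathbb{S})]$ its group algebra. A rule $R$ assigns to each $s_i$ an element $R(s_i)\in\mathbb{E}$, extended by $R(s_i^{-1})=-s_i^{-1}R(s_i)s_{i+1}^{-1}$. The up-arrow $\uparrow$ is the $\mathbb{K}[q]$-linear map replacing each letter $s_i^{\pm1}$ of a word by $s_{i+1}^{\pm1}$. An order $\rho$ is a map rewriting each word by permuting its letters, extended linearly to $\mathbb{E}$. A $q$-grammar is $(S,R,\rho)$; its $q$-derivative is the $\mathbb{K}[q]$-linear map with $D(w_1\cdots w_n)=\sum_{j=1}^n\rho\big(w_1\cdots w_{j-1}R(w_j)\uparrow(w_{j+1}\cdots w_n)\big)$ for letters $w_j\in\mathbb{S}\cup\mathbb{S}^{-1}$, $D^0=\mathrm{id}$, $D^k=D\circ D^{k-1}$. $\mathrm{Gen}^{(G)}_q(f;u)=\sum_{n\ge0}D^n(f)u^n/(q;q)_n$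 with $(q;q)_n=\prod_{i=1}^n(1-q^i)$. An evaluation is a map $\phi$ from $\mathbb{S}$ to a commutative ring $\mathbb{V}$ containing $\mathbb{K}[q]$ (with invertible values), extended to a $\mathbb{K}[q]$-linear ring morphism $\mathbb{E}\to\mathbb{V}$ with $\phi(s_i^{-1})=\phi(s_i)^{-1}$, and applied coefficientwise to power series in $u$. It is master-linear if $\phi(s_i)=\phi(s_j)$ for every $s\in S$ and all $i,j\ge0$. *)

(* Defs.v *)
From HB Require Import structures.
From mathcomp Require Import all_boot all_algebra finmap.
From mathcomp.multinomials Require Import monalg.

Set Implicit Arguments.
Unset Strict Implicit.
Unset Printing Implicit Defensive.

Import GRing.Theory.
Local Open Scope ring_scope.

(* Letters of the free group F(SS), SS = { s_i : s in S, i >= 0 }.     *)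
(* A letter is ((s, i), b): b = false stands for s_i, b = true for     *)
(* s_i^{-1}.                                                           *)
Section FreeGroup.
Variable S : choiceType.

Definition letter := ((S * nat) * bool)%type.

Definition linv (l : letter) : letter := (l.1, ~~ l.2).

Definition rstep (x : letter) (w : seq letter) : seq letter :=
  match w with
  | y :: w' => if y == linv x then w' else x :: w
  | [::] => [:: x]
  end.

Definition reduce (w : seq letter) : seq letter := foldr rstep [::] w.

Fixpoint reducedb (w : seq letter) : bool :=
  match w with
  | [::] => true
  | x :: w' => reducedb w' && (if w' is y :: _ then y != linv x else true)
  end.

Lemma reducedb_reduce (w : seq letter) : reducedb w -> reduce w = w.
Proof.
elim: w => [//|x w IH] /= /andP[rw h]; rewrite IH //.
by case: w {IH rw} h => [//|y w] /= /negbTE ->.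
Qed.

Lemma reduce_reducedb (w : seq letter) : reducedb (reduce w).
Proof.
elim: w => [//|x w] /=; case: (reduce w) => [//|y r] /= /andP[rr h].
case: ifP => [_|/negbT ny] /=; first by [].
by rewrite rr h ny.
Qed.

Lemma reduceK (w : seq letter) : reduce (reduce w) == reduce w.
Proof. by rewrite reducedb_reduce // reduce_reducedb. Qed.

Record fgroup := FGroup { fgword : seq letter; _ : reduce fgword == fgword }.

HB.instance Definition _ := [isSub for fgword].
HB.instance Definition _ := [Choice of fgroup by <:].

Definition toFG (w : seq letter) : fgroup := FGroup (reduceK w).

Definition fgmul (a b : fgroup) : fgroup := toFG (fgword a ++ fgword b).

End FreeGroup.

Section GroupAlgebra.
Variables (K : comNzRingType) (S : choiceType).

Definition Ealg := {malg {poly K}[fgroup S]}.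

Definition wordE (w : seq (letter S)) : Ealg := << toFG w >>.

Definition Emul (f g : Ealg) : Ealg :=
  \sum_(a <- msupp f) \sum_(b <- msupp g) << f@_a * g@_b *g fgmul a b >>.

Definition Elin (h : fgroup S -> Ealg) (f : Ealg) : Ealg :=
  \sum_(a <- msupp f) f@_a *: h a.

Definition upl (l : letter S) : letter S := ((l.1.1, l.1.2.+1), l.2).
Definition upE (f : Ealg) : Ealg :=
  Elin (fun a => wordE (map upl (fgword a))) f.

Definition Rlet (R : S * nat -> Ealg) (l : letter S) : Ealg :=
  if l.2 then
    - Emul (Emul (wordE [:: (l.1, true)]) (R l.1))
           (wordE [:: ((l.1.1, l.1.2.+1), true)])
  else R l.1.

(* an order rho rewrites each (reduced) word by permuting its letters;
   rhoE is its linear extension to E *)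
Definition rhoE (rho : fgroup S -> seq (letter S)) (f : Ealg) : Ealg :=
  Elin (fun a => wordE (rho a)) f.

Definition Dword (R : S * nat -> Ealg) (rho : fgroup S -> seq (letter S))
    (a : fgroup S) : Ealg :=
  let w := fgword a in
  \sum_(j < size w)
     rhoE rho (Emul (Emul (wordE (take j w)) (Rlet R (tnth (in_tuple w) j)))
                    (upE (wordE (drop j.+1 w)))).

Definition qder R rho (f : Ealg) : Ealg := Elin (Dword R rho) f.
Definition qder_iter R rho (n : nat) (f : Ealg) : Ealg := iter n (qder R rho) f.

Definition qpoch (n : nat) : {poly K} := \prod_(i < n) (1 - 'X ^+ i.+1).

Section Eval.
Variables (V : comUnitRingType) (iota : {poly K} -> V) (phi : S * nat -> V).

Definition evall (l : letter S) : V := if l.2 then (phi l.1)^-1 else phi l.1.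
Definition evalw (a : fgroup S) : V := \prod_(l <- fgword a) evall l.
Definition evalE (f : Ealg) : V := \sum_(a <- msupp f) iota f@_a * evalw a.

(* coefficient of u^n in phi(Gen_q(f; u)) : phi(D^n f) / (q;q)_n *)
Definition gen_coef R rho (f : Ealg) (n : nat) : V :=
  evalE (qder_iter R rho n f) / iota (qpoch n).
End Eval.

End GroupAlgebra.

(* Cauchy product of formal power series in u with coefficients in V,
   a series being given by its sequence of coefficients *)
Definition series_mul (V : comNzRingType) (a b : nat -> V) (n : nat) : V :=
  \sum_(k < n.+1) a k * b (n - k)%N.

(* Main.v *)
(** Without the order rho, the q-derivative is a twisted derivation
    d(fg) = d(f) up(g) + f d(g) on the group algebra, and the hypothesis on R
    says that d(up f) = q up(d f).  Write T_n(f) for the n-th coefficient of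
    phi(Gen(f)).  By strong induction on n, the product formula up to degree n
    makes T_n symmetric in the factors of a word, since V is commutative; hence
    T_n is blind to rho, which gives (1 - q^(n+1)) T_(n+1)(f) = T_n(d f) and
    T_n(up f) = q^n T_n(f).  Applied to d(fg), these turn the product formula in
    degree n + 1 into the identity
    1 - q^(n+1) = (1 - q^k) q^(n+1-k) + (1 - q^(n+1-k)). *)

Require Import Defs.
From HB Require Import structures.
From mathcomp Require Import all_boot all_algebra finmap ring.
From mathcomp.multinomials Require Import monalg.
Import GRing.Theory.
Local Open Scope ring_scope.

Set Implicit Arguments.
Unset Strict Implicit.
Unset Printing Implicit Defensive.

(** * The free group *)

Section FreeGroupTheory.
Variable S : choiceType.
Implicit Types (x : letter S) (u v w : seq (letter S)).

Lemma linvK x : linv (linv x) = x.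
Proof. by case: x => p b; rewrite /linv /= negbK. Qed.

Lemma reduce_fgword (a : fgroup S) : reduce (fgword a) = fgword a.
Proof. by case: a => w /= /eqP. Qed.

Lemma toFG_fgword (a : fgroup S) : toFG (fgword a) = a.
Proof. by apply: val_inj; rewrite /= reduce_fgword. Qed.

Lemma toFG_eq u v : reduce u = reduce v -> toFG u = toFG v.
Proof. by move=> e; apply: val_inj. Qed.

(** If [w] starts with [x], that letter is deleted and then put back; as [w] is reduced, its second
    letter is not [linv x], so nothing else cancels. Otherwise the pushed [linv x] is cancelled at
    once. *)
Lemma rstep_linv x w : reducedb w -> rstep x (rstep (linv x) w) = w.
Proof.
case: w => [_|y w] /=; first by rewrite eqxx.
rewrite linvK; case: eqP => [->|_] /= /andP[_ rw]; last by rewrite eqxx.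
by case: w rw => [//|z w] /= /negbTE ->.
Qed.

Lemma foldr_rstep_reducedb u w :
  reducedb w -> reducedb (foldr (@rstep S) w u).
Proof.
move=> rw; rewrite -[w](reducedb_reduce rw) /reduce -foldr_cat.
exact: reduce_reducedb.
Qed.

(** Letters act on reduced words by [rstep], inverse letters by inverse maps, so cancelling inside
    the acting word does not change its action. *)
Lemma foldr_rstep_reduce u w : reducedb w ->
  foldr (@rstep S) w (reduce u) = foldr (@rstep S) w u.
Proof.
move=> rw; elim: u => [//|x u IHu] /=; rewrite -IHu.
case: (reduce u) => [//|y r] /=; case: eqP => [->|//].
by rewrite rstep_linv // foldr_rstep_reducedb.
Qed.

Lemma reduce_catl u v : reduce (reduce u ++ v) = reduce (u ++ v).
Proof.
by rewrite /reduce !foldr_cat foldr_rstep_reduce // reduce_reducedb.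
Qed.

Lemma reduce_catr u v : reduce (u ++ reduce v) = reduce (u ++ v).
Proof.
rewrite /reduce !foldr_cat; congr foldr.
exact: reducedb_reduce (reduce_reducedb v).
Qed.

Lemma upl_inj : injective (@upl S).
Proof. by case=> [[s i] b] [[t j] c] [-> -> ->]. Qed.

Lemma upl_linv x : upl (linv x) = linv (upl x). Proof. by []. Qed.

Lemma reduce_map_upl w : reduce (map (@upl S) w) = map (@upl S) (reduce w).
Proof.
elim: w => [//|x w IHw] /=; rewrite IHw.
case: (reduce w) => [//|y r] /=.
by rewrite -upl_linv (inj_eq upl_inj); case: ifP.
Qed.

End FreeGroupTheory.

(** * Twisted derivations on words *)

Section WordDerivation.
Variables (S : choiceType) (L : comNzRingType) (A : algType L).
Variables (X : letter S -> A) (R : S * nat -> A) (up : {lrmorphism A -> A}).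
Variable q : L.
Implicit Types (x : letter S) (u v w : seq (letter S)).
Hypothesis X_linv : forall x, X x * X (linv x) = 1.
Hypothesis up_X : forall x, up (X x) = X (upl x).

Definition Rl x : A := if x.2 then - (X x * R x.1 * X (upl x)) else R x.1.

Lemma Rl_linv x : Rl x * up (X (linv x)) + X x * Rl (linv x) = 0.
Proof.
rewrite up_X upl_linv; case: x => p []; rewrite /Rl /=.
  by rewrite mulNr -[_ * X (linv _)]mulrA X_linv mulr1 addNr.
by rewrite mulrN !mulrA X_linv mul1r subrr.
Qed.

Definition word w : A := \prod_(x <- w) X x.

Lemma word_cat u v : word (u ++ v) = word u * word v.
Proof. exact: big_cat. Qed.

Lemma word_cons x w : word (x :: w) = X x * word w.
Proof. exact: big_cons. Qed.

Lemma word_map_upl w : word (map (@upl S) w) = up (word w).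
Proof.
by rewrite /word rmorph_prod big_map; apply: eq_bigr => x _; rewrite -up_X.
Qed.

Lemma word_reduce w : word (reduce w) = word w.
Proof.
elim: w => [//|x w IHw]; rewrite [reduce _]/= word_cons -IHw.
case: (reduce w) => [|y r] /=; first exact: word_cons.
case: eqP => [->|_]; last exact: word_cons.
by rewrite word_cons mulrA X_linv mul1r.
Qed.

(** The order-free q-derivative of a possibly unreduced word, in recursive form for inductions on
    words; [dwordE] recovers the sum over positions. *)
Fixpoint dword w : A :=
  if w is x :: w' then Rl x * up (word w') + X x * dword w' else 0.

Lemma dword_cat u v : dword (u ++ v) = dword u * up (word v) + word u * dword v.
Proof.
elim: u => [|x u IHu] /=; first by rewrite /word big_nil mul0r add0r mul1r.
by rewrite IHu word_cat rmorphM word_cons mulrDl mulrDr !mulrA addrA.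
Qed.

(* [Rl_linv] makes the derivative of [x x^-1] vanish, so it descends to the
   free group. *)
Lemma dword_reduce w : dword (reduce w) = dword w.
Proof.
elim: w => [//|x w IHw] /=; rewrite -IHw -word_reduce.
case: (reduce w) => [//|y r] /=; case: eqP => [->|//].
rewrite word_cons rmorphM mulrDr !mulrA X_linv mul1r addrA -mulrDl.
by rewrite Rl_linv mul0r add0r.
Qed.

(** The hypothesis passes from letters to inverse letters because [up] is a ring morphism compatible
    with [X]. Each term of the derivative has exactly one factor [Rl], hence a single factor [q]. *)
Lemma dword_upl (hR : forall s i, R (s, i.+1) = q *: up (R (s, i))) w :
  dword (map (@upl S) w) = q *: up (dword w).
Proof.
have Rl_upl x : Rl (upl x) = q *: up (Rl x).
  case: x => [[s i] []]; rewrite /Rl /= hR // rmorphN !rmorphM /= !up_X scalerN.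
  by rewrite -scalerAr -scalerAl.
elim: w => [|x w IHw] /=; first by rewrite linear0 scaler0.
rewrite IHw word_map_upl Rl_upl -up_X rmorphD !rmorphM scalerDr.
by rewrite -scalerAl -scalerAr.
Qed.

Lemma dwordE w x0 : dword w = \sum_(j < size w)
  word (take j w) * Rl (nth x0 w j) * up (word (drop j.+1 w)).
Proof.
elim: w => [|x w IHw]; first by rewrite big_ord0.
rewrite big_ord_recl /= drop0 {2}/word big_nil mul1r; congr (_ + _).
rewrite IHw mulr_sumr; apply: eq_bigr => j _.
by rewrite [in RHS]word_cons !mulrA.
Qed.

Hypothesis word_span : forall P : A -> Prop, P 0 ->
  (forall f g, P f -> P g -> P (f + g)) -> (forall c f, P f -> P (c *: f)) ->
  (forall w, P (word w)) -> forall f, P f.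
Variable der : {linear A -> A}.
Hypothesis der_word : forall w, der (word w) = dword w.

Lemma derM f g : der (f * g) = der f * up g + f * der g.
Proof.
elim/word_span: f => [|f f' IHf IHf'|c f IHf|u].
- by rewrite !(mul0r, linear0) add0r.
- by rewrite mulrDl !linearD IHf IHf' !mulrDl addrACA.
- by rewrite -scalerAl !linearZZ IHf -!scalerAl scalerDr.
elim/word_span: g => [|g g' IHg IHg'|c g IHg|v].
- by rewrite !(mulr0, linear0) add0r.
- by rewrite mulrDr !linearD IHg IHg' !mulrDr addrACA.
- by rewrite -scalerAr !linearZZ IHg -!scalerAr scalerDr.
by rewrite -word_cat !der_word dword_cat.
Qed.

Lemma der_up (hR : forall s i, R (s, i.+1) = q *: up (R (s, i))) f :
  der (up f) = q *: up (der f).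
Proof.
elim/word_span: f => [|f g IHf IHg|c f IHf|w]; first by rewrite !linear0.
- by rewrite !linearD IHf IHg.
- by rewrite !(linearZZ up, linearZZ der) IHf !scalerA mulrC.
by rewrite -word_map_upl !der_word dword_upl.
Qed.

End WordDerivation.

(** * Product rule for the coefficients of the generating function *)

Section QExponential.
Variables (L : comNzRingType) (A : algType L) (V : comUnitRingType).
Variables (T : eqType) (W : seq T -> A) (up der rho : {linear A -> A}).
Variables (q : L) (iota : {rmorphism L -> V}).
Variable ev : {linear A -> V | iota \; *%R}.
Hypothesis W_cat : forall u v, W (u ++ v) = W u * W v.
Hypothesis W_span : forall P : A -> Prop, P 0 ->
  (forall f g, P f -> P g -> P (f + g)) -> (forall c f, P f -> P (c *: f)) ->
  (forall w, P (W w)) -> forall f, P f.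
Hypothesis derM : forall f g, der (f * g) = der f * up g + f * der g.
Hypothesis der_up : forall f, der (up f) = q *: up (der f).
(** An order permutes the reduced form of a word: [u] stands for that form, [v] for its
    rearrangement. *)
Hypothesis rho_W : forall w,
  exists u v, [/\ perm_eq u v, W w = W u & rho (W w) = W v].
Hypothesis ev_cat : forall u v, ev (W (u ++ v)) = ev (W u) * ev (W v).
Hypothesis ev_up_W : forall w, ev (up (W w)) = ev (W w).

Let poch n : L := \prod_(i < n) (1 - q ^+ i.+1).
Hypothesis poch_unit : forall n, iota (poch n) \is a GRing.unit.

Lemma evM f g : ev (f * g) = ev f * ev g.
Proof.
elim/W_span: f => [|f f' IHf IHf'|c f IHf|u].
- by rewrite mul0r linear0 mul0r.
- by rewrite mulrDl !linearD IHf IHf' mulrDl.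
- by rewrite -scalerAl !linearZ /= IHf mulrA.
elim/W_span: g => [|g g' IHg IHg'|c g IHg|v].
- by rewrite mulr0 linear0 mulr0.
- by rewrite mulrDr !linearD IHg IHg' mulrDr.
- by rewrite -scalerAr !linearZ /= IHg mulrCA.
by rewrite -W_cat ev_cat.
Qed.

Lemma ev_up f : ev (up f) = ev f.
Proof.
elim/W_span: f => [|f g IHf IHg|c f IHf|//]; first by rewrite linear0.
- by rewrite !linearD IHf IHg.
- by rewrite !linearZ /= IHf.
Qed.

Definition qcoef (f : A) (n : nat) : V :=
  ev (iter n (rho \o der) f) / iota (poch n).

Lemma qcoef_linear c f g n :
  qcoef (c *: f + g) n = iota c * qcoef f n + qcoef g n.
Proof.
suff iterP : iter n (rho \o der) (c *: f + g)
    = c *: iter n (rho \o der) f + iter n (rho \o der) g.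
  by rewrite /qcoef iterP linearP mulrDl mulrA.
by elim: n => [//|n IHn] /=; rewrite IHn !linearP.
Qed.

Lemma qcoef0 n : qcoef 0 n = 0.
Proof.
have := qcoef_linear 1 0 0 n; rewrite scale1r addr0 rmorph1 mul1r => e.
by apply: (addrI (qcoef 0 n)); rewrite addr0 -e.
Qed.

Lemma qcoefD f g n : qcoef (f + g) n = qcoef f n + qcoef g n.
Proof. by rewrite -[f]scale1r qcoef_linear rmorph1 mul1r scale1r. Qed.

Lemma qcoefZ c f n : qcoef (c *: f) n = iota c * qcoef f n.
Proof. by rewrite -[c *: f]addr0 qcoef_linear qcoef0 addr0. Qed.

Let Q : V := iota q.

Lemma iota_poch_factor n : iota (poch n.+1) = iota (poch n) * (1 - Q ^+ n.+1).
Proof. by rewrite /poch big_ord_recr rmorphM rmorphB rmorph1 rmorphXn. Qed.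

Lemma poch_factor_unit n : 1 - Q ^+ n.+1 \is a GRing.unit.
Proof.
by have := poch_unit n.+1; rewrite iota_poch_factor unitrM => /andP[].
Qed.

(** On series, applying [rho \o der] is the q-difference quotient (F(u) - F(qu)) / u: the last
    factor of the q-Pochhammer symbol cancels. *)
Lemma qcoefS f n : (1 - Q ^+ n.+1) * qcoef f n.+1 = qcoef (rho (der f)) n.
Proof.
rewrite /qcoef iterSr iota_poch_factor invrM ?poch_unit ?poch_factor_unit //.
by rewrite mulrCA mulVKr ?poch_factor_unit.
Qed.

(** The q-Leibniz rule A(u)B(u) - A(qu)B(qu) = (A(u) - A(qu)) B(qu) + A(u) (B(u) - B(qu)), divided
    by u and read in degree n. *)
Lemma cauchy_qbinomial (a b : nat -> V) n :
  (1 - Q ^+ n.+1) * series_mul a b n.+1 =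
  series_mul (fun k => (1 - Q ^+ k.+1) * a k.+1) (fun k => Q ^+ k * b k) n
  + series_mul a (fun k => (1 - Q ^+ k.+1) * b k.+1) n.
Proof.
(* Both sums on the right are extended to all k <= n+1; each new term carries the factor 1 - Q^0 =
   0. *)
have -> : series_mul (fun k => (1 - Q ^+ k.+1) * a k.+1)
      (fun k => Q ^+ k * b k) n
    = \sum_(k < n.+2) (1 - Q ^+ k) * a k * (Q ^+ (n.+1 - k) * b (n.+1 - k)%N).
  by rewrite big_ord_recl expr0 subrr !mul0r add0r.
have -> : series_mul a (fun k => (1 - Q ^+ k.+1) * b k.+1) n
    = \sum_(k < n.+2) a k * ((1 - Q ^+ (n.+1 - k)) * b (n.+1 - k)%N).
  rewrite big_ord_recr /= subnn expr0 subrr mul0r mulr0 addr0.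
  by apply: eq_bigr => k _; rewrite subSn // -ltnS.
rewrite mulr_sumr -big_split; apply: eq_bigr => k _ /=.
have -> : Q ^+ n.+1 = Q ^+ k * Q ^+ (n.+1 - k).
  by rewrite -exprD subnKC // -ltnS.
ring.
Qed.

Lemma series_mulC (a b : nat -> V) n : series_mul a b n = series_mul b a n.
Proof.
rewrite /series_mul (reindex_inj rev_ord_inj); apply: eq_bigr => k _ /=.
by rewrite subSS mulrC subKn // -ltnS.
Qed.

Let mult_at n := forall f g, qcoef (f * g) n = series_mul (qcoef f) (qcoef g) n.

(** Swapping two blocks in front of a third changes nothing: the Cauchy product with the third
    involves the first two in all degrees up to n, where the product formula and commutativity of
    [V] apply. *)
Lemma qcoef_rho n : (forall m, (m <= n)%N -> mult_at m) ->
  forall f, qcoef (rho f) n = qcoef f n.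
Proof.
move=> multn.
have swap f g m : (m <= n)%N -> qcoef (f * g) m = qcoef (g * f) m.
  by move=> le_mn; rewrite !multn // series_mulC.
elim/W_span => [|f g IHf IHg|c f IHf|w]; first by rewrite linear0.
- by rewrite linearD !qcoefD IHf IHg.
- by rewrite linearZZ !qcoefZ IHf.
have [w1 [w2 [pw -> ->]]] := rho_W w.
(* Such block swaps generate all permutations. *)
apply: (@catCA_perm_ind T (fun u => qcoef (W u) n = qcoef (W w1) n)) pw _ => //.
move=> u v t <-; rewrite !catA !W_cat !(multn n) //.
by apply: eq_bigr => k _; rewrite swap // -ltnS.
Qed.

(** Each descent by [qcoefS] yields one factor [Q] through [der_up], and in degree 0 [ev] does not
    see [up]. The descent precedes the removal of [rho], so the product formula in degrees below n
    suffices. *)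
Lemma qcoef_up n : (forall m, (m < n)%N -> mult_at m) ->
  forall f, qcoef (up f) n = Q ^+ n * qcoef f n.
Proof.
elim: n => [_ f|n IHn multn f]; first by rewrite /qcoef /= ev_up expr0 mul1r.
apply: (mulrI (poch_factor_unit n)).
have rhoK := qcoef_rho multn.
rewrite [RHS]mulrCA !qcoefS !rhoK der_up qcoefZ IHn => [|m lt_mn].
  by rewrite exprS mulrA.
by apply: multn; apply: ltnW.
Qed.

Lemma qcoefM n f g : qcoef (f * g) n = series_mul (qcoef f) (qcoef g) n.
Proof.
elim/ltn_ind: n f g => -[_ f g|n IHn f g].
  rewrite /series_mul big_ord1 /qcoef /= evM /poch big_ord0 rmorph1 invr1.
  by rewrite !mulr1.
apply: (mulrI (poch_factor_unit n)).
have rhoK := qcoef_rho IHn.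
rewrite qcoefS rhoK derM qcoefD !IHn // cauchy_qbinomial.
(* Terms are matched one by one: the power of [Q] is absorbed into [up g], and [qcoefS] turns degree
   k+1 of [f], or of [g] in the second sum, into degree k of its derivative. *)
congr (_ + _); apply: eq_bigr => k _; have le_kn : (k <= n)%N by rewrite -ltnS.
  rewrite -qcoef_up => [|m lt_m]; last first.
    by apply/IHn/leqW/(leq_trans lt_m)/leq_subr.
  by rewrite qcoefS qcoef_rho // => m le_mk; apply/IHn/(leq_ltn_trans le_mk).
rewrite qcoefS qcoef_rho // => m le_m.
by apply/IHn/(leq_ltn_trans le_m)/(leq_ltn_trans (leq_subr _ _)).
Qed.

End QExponential.

(** * The group algebra *)

(* An alias is needed because malg has canonical ring instances, keyed on
   monoids where no element but 1 is invertible. *)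
Definition galg (K : comNzRingType) (S : choiceType) := Ealg K S.
HB.instance Definition _ K S := GRing.Lmodule.on (galg K S).

Section GroupAlgebraTheory.
Variables (K : comNzRingType) (S : choiceType).
Local Notation E := (galg K S).
Local Notation wordE := (@wordE K S).
Implicit Types (f g h : E) (u v w : seq (letter S)).

Lemma scale_malgU (c d : {poly K}) (a : fgroup S) :
  c *: << d *g a >> = << c * d *g a >> :> E.
Proof.
by apply: (malgP _ _).1 => k; rewrite mcoeffZ [in RHS]mcoeffU mcoeffU mulrnAr.
Qed.

Lemma Ealg_ind (P : E -> Prop) :
  P 0 -> (forall f g, P f -> P g -> P (f + g)) ->
  (forall c f, P f -> P (c *: f)) -> (forall w, P (wordE w)) ->
  forall f, P f.
Proof.
move=> P0 PD PZ Pw f; rewrite [f]monalgE.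
elim/big_ind: _ => // a _.
rewrite (_ : << _ *g a >> = f@_a *: wordE (fgword a)).
  exact/PZ/Pw.
by rewrite /Defs.wordE toFG_fgword scale_malgU mulr1.
Qed.

(** Supports vary with the element; linearity is checked over one finite set containing all of
    them. *)
Lemma ElinEw (h : fgroup S -> E) f (d : {fset fgroup S}) :
  (msupp f `<=` d)%fset -> Elin h f = \sum_(a <- d) f@_a *: h a.
Proof.
move=> le; rewrite /Elin (big_fset_incl _ le) // => a _ /mcoeff_outdom ->.
by rewrite scale0r.
Qed.

Lemma Elin_is_linear (h : fgroup S -> E) : linear (Elin h).
Proof.
move=> c f g; pose d := (msupp (c *: f + g) `|` (msupp f `|` msupp g))%fset.
rewrite (@ElinEw h _ d) ?fsubsetUl // (@ElinEw h f d) ?(@ElinEw h g d).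
- rewrite scaler_sumr -big_split; apply: eq_bigr => a _ /=.
  by rewrite mcoeffD mcoeffZ scalerDl scalerA.
- by rewrite /d; apply/fsubsetP => a ag; rewrite !inE ag !orbT.
- by rewrite /d; apply/fsubsetP => a ag; rewrite !inE ag !orbT.
Qed.

HB.instance Definition _ (h : fgroup S -> E) :=
  GRing.isLinear.Build {poly K} E E _ (Elin h) (Elin_is_linear h).

Lemma Elin_wordE (h : fgroup S -> E) w : Elin h (wordE w) = h (toFG w).
Proof. by rewrite /Elin msuppU oner_eq0 big_seq_fset1 mcoeffUU scale1r. Qed.

(** * The product of the group algebra and its ring structure *)

Lemma EmulE f g :
  Emul f g = Elin (fun a => Elin (fun b => wordE (fgword a ++ fgword b)) g) f.
Proof.
apply: eq_bigr => a _; rewrite scaler_sumr; apply: eq_bigr => b _.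
by rewrite /Defs.wordE !scale_malgU !mulr1.
Qed.

Lemma Emul_is_linear f : linear (Emul f).
Proof.
move=> c g h; rewrite !EmulE scaler_sumr -big_split /=.
apply: eq_bigr => a _ /=; rewrite linearP scalerDr !scalerA.
by rewrite [c * _]mulrC.
Qed.

HB.instance Definition _ f :=
  GRing.isLinear.Build {poly K} E E _ (Emul f) (Emul_is_linear f).

Definition Emulr g f := Emul f g.

Lemma Emulr_is_linear g : linear (Emulr g).
Proof. by move=> c f h; rewrite /Emulr !EmulE linearP. Qed.

HB.instance Definition _ g :=
  GRing.isLinear.Build {poly K} E E _ (Emulr g) (Emulr_is_linear g).

HB.instance Definition _ :=
  GRing.isLinear.Build {poly K} E E _ (@upE K S) (Elin_is_linear _).

Lemma EmulDl f g h : Emul (f + g) h = Emul f h + Emul g h.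
Proof. exact: (linearD (Emulr h)). Qed.
Lemma EmulDr f g h : Emul f (g + h) = Emul f g + Emul f h.
Proof. exact: linearD. Qed.
Lemma EmulZl c f g : Emul (c *: f) g = c *: Emul f g.
Proof. exact: (linearZZ (Emulr g)). Qed.
Lemma EmulZr c f g : Emul f (c *: g) = c *: Emul f g.
Proof. exact: linearZZ. Qed.

Lemma wordE_cat u v : wordE (u ++ v) = Emul (wordE u) (wordE v).
Proof.
rewrite EmulE !Elin_wordE /=; congr << _ >>; apply: toFG_eq.
by rewrite reduce_catl reduce_catr.
Qed.

Lemma wordE_linvr x : Emul (wordE [:: x]) (wordE [:: linv x]) = wordE [::].
Proof.
by rewrite -wordE_cat; congr << _ >>; apply: toFG_eq; rewrite /= eqxx.
Qed.

Lemma wordE_reduce w : wordE (reduce w) = wordE w.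
Proof. by congr << _ >>; apply/toFG_eq/reducedb_reduce/reduce_reducedb. Qed.

Lemma upE_wordE w : upE (wordE w) = wordE (map (@upl S) w).
Proof. by rewrite /upE Elin_wordE -reduce_map_upl wordE_reduce. Qed.

Lemma eq_linear_wordE (F G : {linear E -> E}) :
  (forall w, F (wordE w) = G (wordE w)) -> F =1 G.
Proof.
move=> FG; elim/Ealg_ind => [|f g IHf IHg|c f IHf|//].
- by rewrite !linear0.
- by rewrite !linearD IHf IHg.
- by rewrite !linearZZ IHf.
Qed.

Arguments eq_linear_wordE F G : clear implicits.

Lemma Emul1l f : Emul (wordE [::]) f = f.
Proof.
apply: (eq_linear_wordE (Emul (wordE [::])) idfun) => w /=.
by rewrite -wordE_cat.
Qed.

Lemma Emul1r f : Emul f (wordE [::]) = f.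
Proof.
apply: (eq_linear_wordE (Emulr _) idfun) => w /=.
by rewrite /Emulr -wordE_cat cats0.
Qed.

Lemma EmulA f g h : Emul f (Emul g h) = Emul (Emul f g) h.
Proof.
(* Both sides are linear in each argument, so the three arguments are replaced by words one at a
   time. *)
apply: (eq_linear_wordE (Emulr (Emul g h)) (Emulr h \o Emulr g)) => u.
apply: (eq_linear_wordE (Emul _ \o Emulr h) (Emulr h \o Emul _)) => v.
apply: (eq_linear_wordE (Emul _ \o Emul _) (Emul (Emul _ _))) => w /=.
by rewrite -!wordE_cat catA.
Qed.

Lemma upEM f g : upE (Emul f g) = Emul (upE f) (upE g).
Proof.
apply: (eq_linear_wordE (@upE K S \o Emulr g) (Emulr (upE g) \o @upE K S)) => u.
apply: (eq_linear_wordE (@upE K S \o Emul _) (Emul _ \o @upE K S)) => v /=.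
by rewrite -wordE_cat !upE_wordE map_cat wordE_cat.
Qed.

Lemma wordE_nil_neq0 : wordE [::] != 0 :> E.
Proof. by rewrite monalgU_eq0 oner_eq0. Qed.

HB.instance Definition _ := GRing.Zmodule_isNzRing.Build E
  EmulA Emul1l Emul1r EmulDl EmulDr wordE_nil_neq0.

HB.instance Definition _ := GRing.Lmodule_isLalgebra.Build {poly K} E
  (fun c f g => esym (EmulZl c f g)).

HB.instance Definition _ := GRing.Lalgebra_isAlgebra.Build {poly K} E
  (fun c f g => esym (EmulZr c f g)).

Definition upg : E -> E := @upE K S.

HB.instance Definition _ := GRing.Linear.on upg.

Lemma upg_is_monoid_morphism : monoid_morphism upg.
Proof. by split; [exact: upE_wordE | exact: upEM]. Qed.

HB.instance Definition _ :=
  GRing.isMonoidMorphism.Build E E upg upg_is_monoid_morphism.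

Definition gword w : E := wordE w.

Lemma gword_cat u v : gword (u ++ v) = gword u * gword v.
Proof. exact: wordE_cat. Qed.

Local Notation letg := (fun x => gword [:: x]).

Lemma gwordE w : gword w = word letg w.
Proof.
elim: w => [|x w IHw]; first by rewrite /word big_nil.
by rewrite word_cons -IHw -gword_cat.
Qed.

Lemma gword_linv x : gword [:: x] * gword [:: linv x] = 1.
Proof. exact: wordE_linvr. Qed.

Lemma upg_gword w : upg (gword w) = gword (map (@upl S) w).
Proof. exact: upE_wordE. Qed.

Lemma gword_span (P : E -> Prop) : P 0 ->
  (forall f g, P f -> P g -> P (f + g)) -> (forall c f, P f -> P (c *: f)) ->
  (forall w, P (word letg w)) -> forall f, P f.
Proof.
move=> P0 PD PZ Pw; apply: Ealg_ind => // w.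
by rewrite -[X in P X]/(gword w) gwordE.
Qed.

(** * The q-derivative as an order applied after a twisted derivation *)

Section Derivation.
Variable R : S * nat -> E.
Local Notation dw := (dword letg R upg).

Lemma Rl_Rlet x : Rl letg R x = Rlet R x.
Proof. by case: x => p []; exact: erefl. Qed.

(* The q-derivative with the order left out. *)
Definition der : E -> E := Elin (fun a => dw (fgword a)).

HB.instance Definition _ :=
  GRing.isLinear.Build {poly K} E E _ der (Elin_is_linear _).

Lemma dword_gword_reduce w : dw (reduce w) = dw w.
Proof.
by apply: dword_reduce; [exact: gword_linv | move=> x; exact: upg_gword].
Qed.

Lemma der_gword w : der (word letg w) = dw w.
Proof. by rewrite -gwordE /der /gword Elin_wordE dword_gword_reduce. Qed.

Variable rho : fgroup S -> seq (letter S).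

Definition rhog : E -> E := rhoE rho.

HB.instance Definition _ :=
  GRing.isLinear.Build {poly K} E E _ rhog (Elin_is_linear _).

Lemma qderE f : qder R rho f = rhog (der f).
Proof.
apply: (eq_linear_wordE (Elin _) (rhog \o der)) => w.
transitivity (Dword R rho (toFG w)); first exact: Elin_wordE.
rewrite [RHS]/= -[X in der X]/(gword w) gwordE der_gword -dword_gword_reduce.
rewrite -[reduce w]/(fgword (toFG w)) /Dword.
(* The first letter of a nonempty word serves as the default value of [nth] in [dwordE]. *)
case def_w: (fgword _) => [|x0 v]; first by rewrite big_ord0 linear0.
rewrite (dwordE _ _ _ _ x0) linear_sum; apply: eq_bigr => j _.
by rewrite (tnth_nth x0) -!gwordE Rl_Rlet; exact: erefl.
Qed.

End Derivation.

(** * Evaluations as semilinear maps, multiplicative on words *)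

Section Evaluation.
Variables (V : comUnitRingType) (iota : {rmorphism {poly K} -> V}).
Variable phi : S * nat -> V.
Hypothesis phi_unit : forall x : S * nat, phi x \is a GRing.unit.
Definition evg : E -> V := evalE iota phi.

Lemma evgEw f (d : {fset fgroup S}) : (msupp f `<=` d)%fset ->
  evg f = \sum_(a <- d) iota f@_a * evalw phi a.
Proof.
move=> le; rewrite /evg /evalE (big_fset_incl _ le) // => a _ /mcoeff_outdom ->.
by rewrite rmorph0 mul0r.
Qed.

Lemma evg_linear c f g : evg (c *: f + g) = iota c * evg f + evg g.
Proof.
pose d := (msupp (c *: f + g) `|` (msupp f `|` msupp g))%fset.
rewrite (@evgEw _ d) ?fsubsetUl // (@evgEw f d) ?(@evgEw g d).
- rewrite mulr_sumr -big_split; apply: eq_bigr => a _ /=.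
  by rewrite mcoeffD mcoeffZ rmorphD rmorphM mulrDl mulrA.
- by rewrite /d; apply/fsubsetP => a ag; rewrite !inE ag !orbT.
- by rewrite /d; apply/fsubsetP => a ag; rewrite !inE ag !orbT.
Qed.

(** A cancelled pair evaluates to 1 because the values of [phi] are units, so the unreduced word
    gives the same product. *)
Lemma evg_gword w : evg (gword w) = \prod_(l <- w) evall phi l.
Proof.
rewrite /evg /evalE msuppU oner_eq0 big_seq_fset1 mcoeffUU rmorph1 mul1r.
rewrite /evalw /=.
elim: w => [//|x w IHw]; rewrite big_cons -IHw /=.
case: (reduce w) => [|y r]; first by rewrite big_cons.
rewrite /rstep; case: eqP => [->|_]; rewrite ?big_cons // mulrA.
suff -> : evall phi x * evall phi (linv x) = 1 by rewrite mul1r.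
by case: x => p []; rewrite /evall /= ?mulVr ?mulrV.
Qed.

HB.instance Definition _ :=
  GRing.isLinear.Build {poly K} E V (iota \; *%R) evg evg_linear.

Lemma evg_cat u v : evg (gword (u ++ v)) = evg (gword u) * evg (gword v).
Proof. by rewrite !evg_gword big_cat. Qed.

Hypothesis phi_master_linear : forall s i j, phi (s, i) = phi (s, j).

Lemma evg_upg_gword w : evg (upg (gword w)) = evg (gword w).
Proof.
rewrite upg_gword !evg_gword big_map; apply: eq_bigr => -[[s i] b] _.
by rewrite /evall /= (phi_master_linear s i.+1 i).
Qed.

End Evaluation.

End GroupAlgebraTheory.

(** * Multiplicativity of the generating function, coefficient by coefficient *)

Theorem theorem4p14
  (K : comNzRingType)
  (K_char0 : forall n : nat, (0 < n)%N -> n%:R != 0 :> K)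
  (S : choiceType)
  (R : S * nat -> Ealg K S)
  (rho : fgroup S -> seq (letter S))
  (rho_perm : forall a : fgroup S, perm_eq (rho a) (fgword a))
  (hR : forall (s : S) (i : nat), R (s, i.+1) = 'X *: upE (R (s, i)))
  (V : comUnitRingType)
  (iota : {rmorphism {poly K} -> V})
  (iota_inj : injective iota)
  (iota_qpoch : forall n : nat, iota (qpoch K n) \is a GRing.unit)
  (phi : S * nat -> V)
  (phi_unit : forall x : S * nat, phi x \is a GRing.unit)
  (phi_master_linear : forall (s : S) (i j : nat), phi (s, i) = phi (s, j))
  (f g : Ealg K S) :
  forall n : nat,
    gen_coef iota phi R rho (Emul f g) n
    = series_mul (gen_coef iota phi R rho f) (gen_coef iota phi R rho g) n.
Proof.
have coefE h m : gen_coef iota phi R rho h m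
    = qcoef (der R) (rhog rho) 'X (evg iota phi) h m.
  rewrite /gen_coef /qder_iter (eq_iter (qderE R rho)); exact: erefl.
move=> n; rewrite coefE; under [RHS]eq_bigr do rewrite !coefE.
have up_letter x : upg (gword K [:: x]) = gword K [:: upl x] :> galg K S.
  exact: upg_gword.
apply: (qcoefM (up := @upg K S) (@gword_cat K S) (@Ealg_ind K S)).
- exact: (derM (@gword_span K S) (der_gword R)).
- exact: (der_up up_letter (@gword_span K S) (der_gword R)).
- move=> w; exists (reduce w), (rho (toFG w)).
  split; first by rewrite perm_sym rho_perm.
    exact/esym/wordE_reduce.
  exact: Elin_wordE.
- exact: evg_cat.
- exact: evg_upg_gword.
- exact: iota_qpoch.
Qed.
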